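(* Let $f_1,\dots,f_k\in\mathbb{R}[x_1,\dots,x_d]$, let $\mathcal{K}(\mathsf f)=\{x\in\mathbb{R}^d: f_1(x)\ge0,\dots,f_k(x)\ge0\}$, and suppose that the quadratic module $Q(\mathsf f)$ generated by $f_1,\dots,f_k$ is Archimedean. (i) If $h\in\mathbb{R}[x_1,\dots,x_d]$ satisfies $h(x)>0$ for all $x\in\mathcal{K}(\mathsf f)$, then $h\in Q(\mathsf f)$. (ii) Any $Q(\mathsf f)$-positive linear functional $L$ on $\mathbb{R}[x_1,\dots,x_d]$ is a $\mathcal{K}(\mathsf f)$-moment functional, that is, there exists a (positive) Radon measure $\mu$ on $\mathbb{R}^d$ supported on the compact set $\mathcal{K}(\mathsf f)$ such that $L(f)=\int f(x)\,d\mu(x)$ for all $f\in\mathbb{R}[x_1,\dots,x_d]$.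
   Context: $\sum\mathbb{R}[x_1,\dots,x_d]^2$ denotes the set of finite sums of squares of polynomials. The quadratic module generated by $f_1,\dots,f_k$ is $Q(\mathsf f)=\{\sigma_0+f_1\sigma_1+\dots+f_k\sigma_k:\ \sigma_0,\dots,\sigma_k\in\sum\mathbb{R}[x_1,\dots,x_d]^2\}$. It is Archimedean if for every $a\in\mathbb{R}[x_1,\dots,x_d]$ there exists $\lambda>0$ with $\lambda-a\in Q(\mathsf f)$ (this implies that $\mathcal{K}(\mathsf f)$ is compact). A linear functional $L$ is $Q(\mathsf f)$-positive if $L(g)\ge0$ for all $g\in Q(\mathsf f)$. *)

(* Defs.v *)
From HB Require Import structures.
From mathcomp Require Import all_boot all_order all_algebra.
From mathcomp Require Import all_classical all_reals all_analysis.
(* Only the canonical instances are imported: the notations of mpoly clash with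
   those of MathComp-Analysis. *)
From mathcomp Require Import (canonicals) mpoly.

Set Implicit Arguments.
Unset Strict Implicit.
Unset Printing Implicit Defensive.

Import Order.TTheory GRing.Theory Num.Theory.
Import numFieldNormedType.Exports.

Local Open Scope classical_set_scope.
Local Open Scope ring_scope.

Notation polyring R d := (mpoly.mpoly d R).

Notation borel_space R d := (g_sigma_algebraType (@open 'rV[R]_d)).

Definition peval (R : realType) (d : nat) (p : polyring R d) (x : 'rV[R]_d) : R :=
  mpoly.meval (fun j => x ord0 j) p.

Section QuadraticModule.
Variables (R : realType) (d k : nat).

Definition sum_of_squares : set (polyring R d) :=
  [set p | exists s : seq (polyring R d), p = \sum_(g <- s) g ^+ 2].

Definition quadratic_module (f : 'I_k -> polyring R d) : set (polyring R d) :=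
  [set p | exists (sigma0 : polyring R d) (sigma : 'I_k -> polyring R d),
    [/\ sum_of_squares sigma0,
        forall i, sum_of_squares (sigma i)
      & p = sigma0 + \sum_(i < k) f i * sigma i]].

Definition archimedean_qm (Q : set (polyring R d)) : Prop :=
  forall a : polyring R d,
    exists2 lambda : R, 0 < lambda & Q (mpoly.mpolyC d lambda - a).

Definition semialgebraic_set (f : 'I_k -> polyring R d) : set 'rV[R]_d :=
  [set x | forall i, 0 <= peval (f i) x].

Definition positive_on (Q : set (polyring R d)) (L : {scalar polyring R d}) : Prop :=
  forall g, Q g -> 0 <= L g.

End QuadraticModule.

Section MomentFunctional.
Variables (R : realType) (d : nat).

(* The measure is on the Borel sigma-algebra, but compactness is that of the
   usual topology of 'rV[R]_d, hence the type ascription on C. *)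
Definition radon_measure (mu : {measure set (borel_space R d) -> \bar R}) : Prop :=
  (forall C : set 'rV[R]_d, compact C -> (mu C < +oo)%E) /\
  (forall A : set (borel_space R d), measurable A ->
     mu A = ereal_sup [set mu C | C in
              [set C : set 'rV[R]_d | compact C /\ C `<=` A]]).

(* "Supported on K", for a closed set K: the complement of K is mu-null. *)
Definition supported_on (K : set 'rV[R]_d)
    (mu : {measure set (borel_space R d) -> \bar R}) : Prop :=
  mu (~` K) = 0%E.

Definition moment_functional (K : set 'rV[R]_d) (L : {scalar polyring R d}) : Prop :=
  exists mu : {measure set (borel_space R d) -> \bar R},
    [/\ radon_measure mu,
        supported_on K mu
      & forall p : polyring R d,
          mu.-integrable setT (fun x => (peval p x)%:E) /\
          (L p)%:E = (\int[mu]_x (peval p x)%:E)%E].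

End MomentFunctional.

(* Main.v *)
Require Import Defs.
From mathcomp Require Import all_boot all_order all_algebra.
From mathcomp Require Import all_classical all_reals all_analysis.
From mathcomp Require Import (canonicals) mpoly.
From mathcomp Require Import measurable_realfun.
From mathcomp Require Import ring lra.

Import Order.TTheory GRing.Theory Num.Theory.
Import numFieldNormedType.Exports.

Set Implicit Arguments.
Unset Strict Implicit.
Unset Printing Implicit Defensive.

Local Open Scope classical_set_scope.
Local Open Scope ring_scope.

(** Both parts rest on the same device. A convex cone (or a quadratic module)
that is maximal among the cones (or the quadratic modules) avoiding -1 contains
v or -v for every v, so each v bounded by multiples of the unit u defines a
Dedekind cut of the reals: its value is the threshold x at which
v - r u stops belonging to the cone as r grows past x. The value is linear in v
and nonnegative on the cone ([cone_value] and the lemmas about it).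

Part (i). If -1 were not of the form q - s h with q in Q(f) and s a sum of
squares, then Q(f) - s h would extend to a maximal quadratic module. There the
value map is even multiplicative, because
(e + a)^2 (e - a) + (e - a)^2 (e + a) = 2 e (e^2 - a^2) shows that squares of
elements of value 0 have value 0; hence it is the evaluation at a point of K(f)
at which h is at most 0, against the hypothesis. So s h - 1 lies in Q(f) for
some s, and a descent ([qmodule_sos_factor]) turns this into h in Q(f).

Part (ii). By (i), L is nonnegative on polynomials that are nonnegative on
K = K(f), and the same maximality argument, now in the space of all functions
on R^d, extends L to a positive functional alpha on the functions bounded on K
([positive_extension]). So alpha gives a mass to every subset of K, but it is
only finitely additive. Countable additivity comes from Lebesgue measure on the
line: splitting K successively by a sequence of subsets, and the interval
[0, alpha(1)[ into adjacent half-open intervals whose lengths are the masses of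
the pieces, associates with t in the interval a decreasing sequence of
nonempty pieces of K. When the subsets separate the points of K uniformly,
these pieces shrink to a point X(t) of K, and the image of Lebesgue measure
under X represents alpha on continuous functions, since at a finite stage both
sides are, up to a small error, the same Riemann sum ([integral_walk],
[compact_representing_measure]). The image measure is finite and carried by K,
so it is a Radon measure by the inner regularity of finite Borel measures on a
metric space ([borel_closed_approximable]). Compactness of K holds since K is
closed and the Archimedean hypothesis bounds the coordinates on K. *)

(** * Maximal cones and the values they define *)

Section MaximalStableSet.
Variables (V : nmodType) (S : set (V -> V)).

Definition stable (Q : set V) :=
  (forall a b, Q a -> Q b -> Q (a + b)) /\
  (forall s a, S s -> Q a -> Q (s a)).

(** Zorn's lemma for the two kinds of sets needed below: convex cones (unary
operations: multiplication by nonnegative scalars) and quadratic modules (unary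
operations: multiplication by squares). *)
Lemma exists_maximal_stable (M : set V) (e : V) : stable M -> ~ M e ->
  exists Q : set V, [/\ M `<=` Q, stable Q, ~ Q e &
    forall Q', Q `<=` Q' -> stable Q' -> ~ Q' e -> Q' `<=` Q].
Proof.
move=> [MD MS] Me.
(* The union with M makes the empty chain harmless: its union is M itself. *)
pose P (Q : set V) := stable (Q `|` M) /\ ~ (Q `|` M) e.
have [F FP totF|Q [[Qst Qe] Qmax]] := @Zorn_bigcup V P.
  have key a b : (\bigcup_(X in F) X `|` M) a -> (\bigcup_(X in F) X `|` M) b ->
      (M a /\ M b) \/ exists X, [/\ F X, (X `|` M) a & (X `|` M) b].
    move=> [[X FX Xa]|Ma] [[Y FY Yb]|Mb].
    - right; have [XY|YX] := totF _ _ FX FY.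
        by exists Y; split; [|left; apply: XY|left].
      by exists X; split; [|left|left; apply: YX].
    - by right; exists X; split => //; [left|right].
    - by right; exists Y; split => //; [right|left].
    - by left.
  split; first split.
  - move=> a b Ua Ub; case: (key _ _ Ua Ub) => [[Ma Mb]|[X [FX Xa Xb]]].
      by right; apply: MD.
    have [[XD _] _] := FP _ FX.
    by case: (XD _ _ Xa Xb) => [?|?]; [left; exists X|right].
  - move=> s a Ss Ua; case: (key _ _ Ua Ua) => [[Ma _]|[X [FX Xa _]]].
      by right; apply: MS.
    have [[_ XS] _] := FP _ FX.
    by case: (XS _ _ Ss Xa) => [?|?]; [left; exists X|right].
  - move=> Ue; case: (key _ _ Ue Ue) => [[]//|[X [FX Xe _]]].
    by have [_] := FP _ FX; apply.
exists (Q `|` M); split=> [x Mx||//|]; [by right|exact: Qst|].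
move=> Q' sQ Q'st Q'e x Q'x; apply: contrapT => Qx.
have Q'M : Q' `|` M = Q' by apply/setUidl => y My; apply: sQ; right.
apply: (Qmax Q'); last by rewrite /P Q'M.
split; first by move=> y Qy; apply: sQ; left.
by move=> /(_ x Q'x) Qx'; apply: Qx; left.
Qed.

End MaximalStableSet.

Section ConeValue.
Variables (R : realType) (V : lmodType R).
Implicit Types (C : set V) (u v w : V) (x y : R).

Definition nonneg_scaling : set (V -> V) :=
  [set s | exists2 r : R, 0 <= r & s = *:%R r].

Definition cone C := stable nonneg_scaling C.

Lemma coneD C v w : cone C -> C v -> C w -> C (v + w).
Proof. by case=> + _; apply. Qed.

Lemma coneZ C r v : cone C -> 0 <= r -> C v -> C (r *: v).
Proof. by move=> [_ CZ] r0; apply: CZ; exists r. Qed.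

Lemma coneZE C r v : cone C -> 0 < r -> C (r *: v) -> C v.
Proof.
move=> Cc r0 /(@coneZ _ r^-1 _ Cc); rewrite scalerA mulVf ?gt_eqF// scale1r.
by apply; rewrite invr_ge0 ltW.
Qed.

(** If neither v nor -v could be added to C, then e = c + r v = c' - r' v with
r, r' > 0, and eliminating v gives (r + r') e in C. *)
Lemma maximal_cone_total C e : cone C -> C 0 -> ~ C e ->
  (forall C', C `<=` C' -> cone C' -> ~ C' e -> C' `<=` C) ->
  forall v, C v \/ C (- v).
Proof.
move=> Cc C0 Ce Cmax v.
have ext w : C w \/ exists c r, [/\ C c, 0 < r & e = c + r *: w].
  pose C' := [set z | exists c r, [/\ C c, 0 <= r & z = c + r *: w]].
  have CC' : C `<=` C' by move=> c Cw; exists c, 0; rewrite scale0r addr0.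
  have C'c : cone C'.
    split=> [_ _ [c [r [Cc1 r0 ->]]] [c' [r' [Cc2 r'0 ->]]]|].
      exists (c + c'), (r + r'); split; first exact: coneD.
        exact: addr_ge0.
      by rewrite scalerDl addrACA.
    move=> _ _ [s s0 ->] [c [r [Cc1 r0 ->]]].
    exists (s *: c), (s * r); split; first exact: coneZ.
      exact: mulr_ge0.
    by rewrite scalerDr scalerA.
  have [[c [r [Cc1 r0 ee]]]|C'e] := pselect (C' e).
    move: r0; rewrite le_eqVlt => /orP[/eqP r0|r0]; last by right; exists c, r.
    by case: Ce; rewrite ee -r0 scale0r addr0.
  left; apply: (Cmax C') => //; exists 0, 1; split => //.
  by rewrite scale1r add0r.
have [|[c [r [Cc1 r0 e1]]]] := ext v; first by left.
have [|[c' [r' [Cc2 r'0 e2]]]] := ext (- v); first by right.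
case: Ce; apply: (@coneZE C (r' + r)) => //; first exact: addr_gt0.
rewrite scalerDl {1}e1 e2 scalerN !scalerDr !scalerA.
rewrite addrACA scalerN scalerA (mulrC r') subrr addr0.
by apply: coneD => //; apply: coneZ => //; apply: ltW.
Qed.

(** The cone C need not be closed, so v - x u may or may not belong to it when
x is the value; hence the epsilons. *)
Definition cone_value C u v x := forall e, 0 < e ->
  C (v - (x - e) *: u) /\ C ((x + e) *: u - v).

Section TotalCone.
Variables (C : set V) (u : V).
Hypotheses (Cc : cone C) (Cu : C u) (CNu : ~ C (- u)).

Lemma cone_unit_ge0 r : C (r *: u) -> 0 <= r.
Proof.
move=> Cr; rewrite leNgt; apply/negP => r0; apply: CNu.
apply: (@coneZE C (- r)) => //; first by rewrite oppr_gt0.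
by rewrite scalerN scaleNr opprK.
Qed.

(** The value is the supremum of the r such that v - r u is in C; above it,
totality puts r u - v in C. *)
Lemma cone_value_exists v l : (forall w, C w \/ C (- w)) ->
  C (l *: u - v) -> C (l *: u + v) -> exists x, cone_value C u v x.
Proof.
move=> Ctot Cl1 Cl2; pose E := [set r | C (v - r *: u)].
have Eub : ubound E l.
  move=> r /(coneD Cc Cl1); rewrite addrA subrK -scalerBl.
  by move=> /cone_unit_ge0; rewrite subr_ge0.
have supE : has_sup E.
  by split; [exists (- l); rewrite /E /= scaleNr opprK addrC|exists l].
exists (sup E) => e e0; split.
  have [r Er xr] := sup_adherent e0 supE.
  rewrite -(subrK (r *: u) v) -addrA -scalerBl; apply: coneD => //.
  by apply: coneZ => //; rewrite subr_ge0 ltW.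
have [CN|] := Ctot (v - (sup E + e) *: u); last by rewrite opprB.
have : E (sup E + e) by [].
move=> /(ub_le_sup supE.2); rewrite gerDl => e0'.
by move: e0; rewrite ltNge e0'.
Qed.

Lemma cone_value_uniq v x y : cone_value C u v x -> cone_value C u v y -> x = y.
Proof.
suff le a b : cone_value C u v a -> cone_value C u v b -> a <= b.
  by move=> vx vy; apply/le_anti; rewrite !le.
move=> va vb; apply/ler_addgt0Pr => e e0.
have e2 : 0 < e / 2 by rewrite divr_gt0.
have [va1 _] := va _ e2; have [_ vb2] := vb _ e2.
have := coneD Cc vb2 va1; rewrite addrA subrK -scalerBl.
by move=> /cone_unit_ge0; rewrite subr_ge0 => h; lra.
Qed.

Lemma cone_valueD v w x y : cone_value C u v x -> cone_value C u w y ->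
  cone_value C u (v + w) (x + y).
Proof.
move=> vx wy e e0.
have e2 : 0 < e / 2 by rewrite divr_gt0.
have [v1 v2] := vx _ e2; have [w1 w2] := wy _ e2.
split; [move: (coneD Cc v1 w1)|move: (coneD Cc v2 w2)];
  rewrite addrACA -opprD -scalerDl; congr (C (_ + _)).
- by congr (- (_ *: _)); field.
- by congr (_ *: _); field.
Qed.

Lemma cone_valueN v x : cone_value C u v x -> cone_value C u (- v) (- x).
Proof.
move=> vx e /vx[v1 v2]; split.
  by rewrite -[- x - e]opprD scaleNr opprK addrC.
by have -> : - x + e = - (x - e); [ring|rewrite scaleNr opprK addrC].
Qed.

Lemma cone_valueZ r v x : cone_value C u v x -> cone_value C u (r *: v) (r * x).
Proof.
wlog r0 : r v x / 0 <= r.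
  move=> wl vx; have [r0|r0] := leP 0 r; first exact: wl.
  rewrite -[r *: v]opprK -scaleNr -[r * x]opprK -mulNr.
  by apply: cone_valueN; apply: wl => //; rewrite oppr_ge0 ltW.
move=> vx e e0.
have d0 : 0 < e / (r + 1) by rewrite divr_gt0// ltr_wpDl.
have [v1 v2] := vx _ d0.
have re : 0 <= e - r * (e / (r + 1)).
  have -> : e - r * (e / (r + 1)) = e / (r + 1).
    by field; rewrite gt_eqF// ltr_wpDl.
  exact: ltW.
set d := e / (r + 1) in d0 v1 v2 re.
split.
  have -> : r *: v - (r * x - e) *: u =
      r *: (v - (x - d) *: u) + (e - r * d) *: u.
    rewrite scalerBr scalerA -addrA; congr (_ + _).
    rewrite -[in LHS]scaleNr -[- (_ *: u)]scaleNr -scalerDl.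
    by congr (_ *: _); rewrite /d; ring.
  by apply: coneD => //; apply: coneZ.
have -> : (r * x + e) *: u - r *: v =
    r *: ((x + d) *: u - v) + (e - r * d) *: u.
  rewrite scalerBr scalerA addrAC -scalerDl; congr (_ *: _ - _).
  by ring.
by apply: coneD => //; apply: coneZ.
Qed.

Lemma cone_value_unit : cone_value C u u 1.
Proof.
move=> e /ltW e0; rewrite scalerBl scalerDl scale1r opprB addrC subrK.
by rewrite addrAC subrr add0r; split; apply: coneZ.
Qed.

Lemma cone_value_ge0 v x : C v -> cone_value C u v x -> 0 <= x.
Proof.
move=> Cv vx; apply/ler_addgt0Pr => e e0; have [_] := vx _ e0.
by move=> /(coneD Cc Cv); rewrite addrC subrK => /cone_unit_ge0.
Qed.

Lemma cone_value0 v : C v -> C (- v) -> cone_value C u v 0.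
Proof.
move=> Cv CNv e e0; rewrite sub0r add0r scaleNr opprK.
by split; [rewrite addrC|]; apply: coneD => //; apply: coneZ => //; apply: ltW.
Qed.

End TotalCone.
End ConeValue.

(** * Archimedean quadratic modules in commutative algebras *)

Section QuadraticModules.
Variables (R : realType) (A : comAlgType R).
Implicit Types (Q M : set A) (a b h : A).

Definition square_multiplication : set (A -> A) :=
  [set s | exists a : A, s = *%R (a ^+ 2)].

Definition qmodule Q := stable square_multiplication Q /\ Q 1.

Definition archimedean Q := forall a, exists l : R, Q (l%:A - a).

(** In a polynomial ring this is [sum_of_squares], up to conversion. *)
Definition sos : set A := [set p | exists s : seq A, p = \sum_(g <- s) g ^+ 2].

Lemma sos_sqr a : sos (a ^+ 2).
Proof. by exists [:: a]; rewrite big_seq1. Qed.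

Lemma sos0 : sos 0.
Proof. by exists [::]; rewrite big_nil. Qed.

Lemma sosD a b : sos a -> sos b -> sos (a + b).
Proof. by move=> [s ->] [t ->]; exists (s ++ t); rewrite big_cat. Qed.

Lemma sosM a b : sos b -> sos (a ^+ 2 * b).
Proof.
move=> [s ->]; exists [seq a * g | g <- s]; rewrite big_map big_distrr/=.
by apply: eq_bigr => g _; rewrite exprMn.
Qed.

Section Closure.
Variable Q : set A.
Hypothesis Qq : qmodule Q.

Lemma qmoduleD a b : Q a -> Q b -> Q (a + b).
Proof. by case: Qq => -[+ _] _; apply. Qed.

Lemma qmodule_sqrM a b : Q b -> Q (a ^+ 2 * b).
Proof. by move=> Qb; case: Qq => -[_ QS] _; apply: QS => //; exists a. Qed.

Lemma qmodule0 : Q 0.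
Proof. by have := qmodule_sqrM 0 Qq.2; rewrite expr0n mul0r. Qed.

Lemma qmodule_sosM s a : sos s -> Q a -> Q (s * a).
Proof.
move=> [t ->] Qa; rewrite big_distrl/=.
by elim/big_ind: _ => [|x y|g _]; [exact: qmodule0|exact: qmoduleD|
  exact: qmodule_sqrM].
Qed.

Lemma sos_qmodule s : sos s -> Q s.
Proof. by move=> ss; rewrite -[s]mulr1; apply: qmodule_sosM => //; apply Qq.2. Qed.

Lemma qmodule_cone : cone Q.
Proof.
split=> [a b|_ a [r r0 ->] Qa]; first exact: qmoduleD.
suff -> : r *: a = (Num.sqrt r)%:A ^+ 2 * a by exact: qmodule_sqrM.
by rewrite exprZn expr1n sqr_sqrtr// -scalerAl mul1r.
Qed.

(** The elements a with a and -a in Q form an ideal, because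
4 b = (b + 1)^2 - (b - 1)^2. *)
Lemma qmodule_ideal a b : Q a -> Q (- a) -> Q (b * a).
Proof.
move=> Qa QNa; apply: (@coneZE _ _ _ 4%:R _ qmodule_cone) => //.
suff -> : 4%:R *: (b * a) = (b + 1) ^+ 2 * a + (b - 1) ^+ 2 * - a.
  by apply: qmoduleD; exact: qmodule_sqrM.
by rewrite scaler_nat; ring.
Qed.

(** The quadratic module generated by Q and h. *)
Definition qmodule_adjoin h : set A :=
  [set z | exists q s, [/\ Q q, sos s & z = q + s * h]].

Lemma qmodule_adjoinP h : qmodule (qmodule_adjoin h).
Proof.
split; last by exists 1, 0; split; [exact: Qq.2|exact: sos0|rewrite mul0r addr0].
split=> [_ _ [q [s [Qq1 ss ->]]] [q' [s' [Qq2 ss' ->]]]|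
         _ _ [a ->] [q [s [Qq1 ss ->]]]].
  exists (q + q'), (s + s'); split; [exact: qmoduleD|exact: sosD|].
  by rewrite mulrDl addrACA.
exists (a ^+ 2 * q), (a ^+ 2 * s); split; [exact: qmodule_sqrM|exact: sosM|].
by rewrite mulrDr mulrA.
Qed.

Lemma qmodule_adjoin_sub h : Q `<=` qmodule_adjoin h.
Proof.
by move=> q Qq1; exists q, 0; split; [|exact: sos0|rewrite mul0r addr0].
Qed.

Lemma qmodule_adjoin_gen h : qmodule_adjoin h h.
Proof.
exists 0, (1 ^+ 2); split; [exact: qmodule0|exact: sos_sqr|].
by rewrite expr1n mul1r add0r.
Qed.

(** If a and -a both failed, -1 = q + s a = q' - t a with s and t sums of
squares. Eliminating a gives -(s + t) in Q, so t and -t are in Q. Such t form an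
ideal, so -t a is in Q, and then so is -1 = q' - t a. *)
Lemma maximal_qmodule_total : ~ Q (- 1) ->
  (forall Q', Q `<=` Q' -> stable square_multiplication Q' -> ~ Q' (- 1) ->
    Q' `<=` Q) ->
  forall a, Q a \/ Q (- a).
Proof.
move=> QN1 Qmax a.
have ext b : Q b \/ exists q s, [/\ Q q, sos s & - 1 = q + s * b].
  have [|N1] := pselect (qmodule_adjoin b (- 1)); first by right.
  left; apply: (Qmax _ (@qmodule_adjoin_sub b)) => //.
    exact: (qmodule_adjoinP b).1.
  exact: qmodule_adjoin_gen.
have [|[q [s [Qq1 ss e1]]]] := ext a; first by left.
have [|[q' [t [Qq2 st e2]]]] := ext (- a); first by right.
case: QN1.
have QNst : Q (- (s + t)).
  suff -> : - (s + t) = t * q + s * q'.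
    by apply: qmoduleD; exact: qmodule_sosM.
  have -> : q = - 1 - s * a by rewrite e1 addrK.
  have -> : q' = - 1 - t * - a by rewrite e2 addrK.
  by ring.
have QNt : Q (- t).
  have -> : - t = - (s + t) + s by ring.
  by apply: qmoduleD => //; exact: sos_qmodule.
rewrite e2 mulrC; apply: qmoduleD => //.
by apply: qmodule_ideal => //; exact: sos_qmodule.
Qed.

End Closure.

Definition character (s : A -> R) := [/\ forall a b, s (a + b) = s a + s b,
  forall a b, s (a * b) = s a * s b & forall r, s r%:A = r].

Section Character.
Variable Q : set A.
Hypotheses (Qq : qmodule Q) (Qarch : archimedean Q) (QN1 : ~ Q (- 1)).
Let Qc := qmodule_cone Qq.

(** This is the step that makes the value map multiplicative. A quadratic
module is not closed under products, but when e + a and e - a lie in Q so does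
(e + a)^2 (e - a) + (e - a)^2 (e + a) = 2 e (e^2 - a^2). *)
Lemma cone_value_sqr0 a : cone_value Q 1 a 0 -> cone_value Q 1 (a ^+ 2) 0.
Proof.
move=> a0 e e0; rewrite sub0r add0r; split.
  rewrite scaleNr opprK; apply: (qmoduleD Qq).
    exact/(sos_qmodule Qq)/sos_sqr.
  by apply: coneZ (ltW e0) Qq.2.
set d : A := (Num.sqrt e)%:A.
have -> : e *: 1 = d ^+ 2.
  by rewrite exprZn expr1n sqr_sqrtr// ltW.
have s0 : 0 < Num.sqrt e by rewrite sqrtr_gt0.
have [+ Qd2] := a0 _ s0; rewrite sub0r scaleNr opprK => Qd1.
rewrite add0r -/d in Qd1 Qd2.
apply: (@coneZE _ _ _ (2%:R * Num.sqrt e) _ Qc); first exact: mulr_gt0.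
suff -> : (2%:R * Num.sqrt e) *: (d ^+ 2 - a ^+ 2) =
    (d + a) ^+ 2 * (d - a) + (d - a) ^+ 2 * (a + d).
  by apply: (qmoduleD Qq); exact: qmodule_sqrM.
by rewrite -scalerA scaler_nat -[_ *: (d ^+ 2 - _)]mulr_algl -/d; ring.
Qed.

(** Multiplicativity reduces to squares by polarization, and squares reduce to
elements of value 0 by c^2 = (c - z)^2 + 2 z (c - z) + z^2. *)
Lemma cone_valueM a b x y : cone_value Q 1 a x -> cone_value Q 1 b y ->
  cone_value Q 1 (a * b) (x * y).
Proof.
have unit1 := cone_value_unit Qc Qq.2.
have valZ := cone_valueZ Qc Qq.2.
have valD := cone_valueD Qc.
have sqr c z : cone_value Q 1 c z -> cone_value Q 1 (c ^+ 2) (z ^+ 2).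
  move=> cz; have cz0 : cone_value Q 1 (c - z%:A) 0.
    have -> : 0 = z - z * 1 by rewrite mulr1 subrr.
    apply: (valD) => //.
    by apply: cone_valueN; exact: (valZ).
  have -> : c ^+ 2 = (c - z%:A) ^+ 2 + (2 * z) *: (c - z%:A) + (z ^+ 2)%:A.
    have -> : (z ^+ 2)%:A = z%:A ^+ 2 :> A by rewrite exprZn expr1n.
    rewrite -scalerA scaler_nat -[z *: (c - _)]mulr_algl.
    by move: z%:A => Z; ring.
  rewrite [X in cone_value _ _ _ X](_ : _ = 0 + 2 * z * 0 + z ^+ 2 * 1); last first.
    by ring.
  apply: (valD) => //; last exact: (valZ).
  apply: (valD) => //; first exact: cone_value_sqr0.
  exact: (valZ).
move=> ax bY.
have -> : a * b = 4^-1 *: ((a + b) ^+ 2 - (a - b) ^+ 2).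
  have -> : (a + b) ^+ 2 - (a - b) ^+ 2 = 4%:R *: (a * b).
    by rewrite scaler_nat; ring.
  by rewrite scalerA mulVf ?scale1r.
have -> : x * y = 4^-1 * ((x + y) ^+ 2 - (x - y) ^+ 2) by field.
apply: (valZ).
apply: (valD) => //; first exact/sqr/valD.
by apply: cone_valueN; apply: (sqr); apply: (valD) => //; apply: cone_valueN.
Qed.

Lemma total_qmodule_character : (forall a, Q a \/ Q (- a)) ->
  exists2 s, character s & forall a, Q a -> 0 <= s a.
Proof.
move=> Qtot.
have ex a : exists x, cone_value Q 1 a x.
  have [l1 Ql1] := Qarch a; have [l2 Ql2] := Qarch (- a).
  pose l := Num.max l1 l2.
  apply: (cone_value_exists Qc Qq.2 QN1 (l := l) Qtot).
    have -> : l *: 1 - a = (l1%:A - a) + (l - l1)%:A by rewrite scalerBl; ring.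
    apply: coneD => //; apply: coneZ => //; last exact: Qq.2.
    by rewrite subr_ge0 le_max lexx.
  have -> : l *: 1 + a = (l2%:A - - a) + (l - l2)%:A by rewrite scalerBl; ring.
  apply: coneD => //; apply: coneZ => //; last exact: Qq.2.
  by rewrite subr_ge0 le_max lexx orbT.
have [s sP] := choice ex.
have uniq := cone_value_uniq Qc QN1.
exists s; first split.
- by move=> a b; apply: (uniq (a + b)) => //; apply: cone_valueD.
- by move=> a b; apply: (uniq (a * b)) => //; apply: cone_valueM.
- move=> r; apply: (uniq r%:A) => //; rewrite -[X in cone_value _ _ _ X]mulr1.
  apply: cone_valueZ => //; first exact: Qq.2.
  by apply: cone_value_unit => //; exact: Qq.2.
- by move=> a Qa; apply: (cone_value_ge0 Qc QN1 Qa).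
Qed.

End Character.

Section Positivstellensatz.
Variable M : set A.
Hypotheses (Mq : qmodule M) (March : archimedean M).
Let Mc := qmodule_cone Mq.

Lemma archimedean_ge a r : exists2 l, r <= l & M (l%:A - a).
Proof.
have [l Ml] := March a; exists (Num.max l r); first by rewrite le_max lexx orbT.
have -> : (Num.max l r)%:A - a = (l%:A - a) + (Num.max l r - l)%:A.
  by rewrite scalerBl; ring.
apply: coneD => //; apply: coneZ => //; last exact: Mq.2.
by rewrite subr_ge0 le_max lexx.
Qed.

(** Jacobi's descent. Choose k with 2 k - s and 2 k - 1 - s^2 h in M. Whenever
h + r is in M with r >= 0, the identity
k^2 (h + r) - 1
  = (k - s)^2 (h + r) + 2 k (s h - 1) + r s (2 k - s) + (2 k - 1 - s^2 h)
puts h + (r - 1/k^2) in M. Starting from some r given by the Archimedean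
property, finitely many such steps of the same length make r negative. *)
Lemma qmodule_sos_factor h s : sos s -> M (s * h - 1) -> M h.
Proof.
move=> ss Msh.
have [l0 l00 Ml0] := archimedean_ge s 1.
have [k kl Mk] := archimedean_ge (1 + s ^+ 2 * h) l0.
have k0 : 0 < k by apply: lt_le_trans kl; apply: lt_le_trans l00.
pose K : A := k%:A.
have M2ks : M (2 *: K - s).
  have -> : 2 *: K - s = (l0%:A - s) + (2 * k - l0)%:A.
    by rewrite scalerBl -scalerA; ring.
  apply: coneD => //; apply: coneZ => //; last exact: Mq.2.
  by lra.
have M2k1 : M (2 *: K - 1 - s ^+ 2 * h).
  have -> : 2 *: K - 1 - s ^+ 2 * h = (k%:A - (1 + s ^+ 2 * h)) + K.
    by rewrite scaler_nat /K; ring.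
  by apply: coneD => //; apply: coneZ => //; [exact: ltW|exact: Mq.2].
have M_le0 r : r <= 0 -> M (h + r%:A) -> M h.
  move=> r0 Mhr; have -> : h = h + r%:A + (- r)%:A by rewrite scaleNr addrK.
  apply: coneD => //; apply: coneZ => //; last exact: Mq.2.
  by rewrite oppr_ge0.
have step r : 0 <= r -> M (h + r%:A) -> M (h + (r - k^-1 ^+ 2)%:A).
  move=> r0 Mhr; have k2 : k ^+ 2 != 0 by rewrite expf_neq0// gt_eqF.
  apply: (@coneZE _ _ _ (k ^+ 2) _ Mc); first exact: exprn_gt0.
  have -> : k ^+ 2 *: (h + (r - k^-1 ^+ 2)%:A) = K ^+ 2 * (h + r%:A) - 1.
    rewrite scalerBl addrA scalerBr scalerA exprVn mulfV// scale1r.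
    by rewrite exprZn expr1n mulr_algl.
  have -> : K ^+ 2 * (h + r%:A) - 1 = (K - s) ^+ 2 * (h + r%:A) +
      2 *: (K * (s * h - 1)) + r *: (s * (2 *: K - s)) +
      (2 *: K - 1 - s ^+ 2 * h).
    rewrite !scaler_nat -[r *: (s * _)]mulr_algl.
    by move: r%:A => r1; ring.
  apply: (coneD Mc) => //; apply: (coneD Mc).
    apply: (coneD Mc); first exact: qmodule_sqrM.
    by rewrite /K mulr_algl; do 2!apply: coneZ => //; exact: ltW.
  by apply: coneZ => //; exact: qmodule_sosM.
have iter n r : r <= n%:R * k^-1 ^+ 2 -> M (h + r%:A) -> M h.
  elim: n r => [|n IHn] r; first by rewrite mul0r => r0; exact: M_le0.
  move=> rn Mhr; have [r0|r0] := leP r 0; first exact: (M_le0 r).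
  apply: (IHn (r - k^-1 ^+ 2)); last exact: step (ltW r0) Mhr.
  by rewrite lerBlDr -(addn1 n) natrD mulrDl mul1r in rn *.
have [r Mr] := March (- h).
apply: (iter (Num.bound `|r / k^-1 ^+ 2|) r); last by rewrite addrC -[h]opprK.
rewrite -ler_pdivrMr ?exprn_gt0 ?invr_gt0//.
by rewrite (le_trans (ler_norm _))// ltW// archi_boundP.
Qed.

(** A maximal quadratic module containing M and -h would define a character
with value at most 0 at h. *)
Theorem archimedean_positivstellensatz h :
  (forall s, character s -> (forall a, M a -> 0 <= s a) -> 0 < s h) -> M h.
Proof.
move=> hpos; have [|N1] := pselect (qmodule_adjoin M (- h) (- 1)).
  move=> [q [s [Mq1 ss e]]]; apply: (@qmodule_sos_factor h s ss).
  suff -> : s * h - 1 = q by [].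
  by rewrite e; ring.
have [Mhst Mh1] := qmodule_adjoinP Mq (- h).
have [Q [MQ Qst QN1 Qmax]] := exists_maximal_stable Mhst N1.
have Qq : qmodule Q by split => //; exact: MQ.
have Qarch : archimedean Q.
  by move=> a; have [l Ml] := March a; exists l; apply/MQ/qmodule_adjoin_sub.
have Qtot := maximal_qmodule_total Qq QN1 Qmax.
have [s sc sQ] := total_qmodule_character Qq Qarch QN1 Qtot.
have [sD sM sr] := sc.
have : 0 < s h by apply: hpos => // a Ma; apply/sQ/MQ/qmodule_adjoin_sub.
have : 0 <= s (- h) by apply/sQ/MQ/qmodule_adjoin_gen.
have -> : s (- h) = - s h.
  by rewrite -mulN1r sM -[- 1]scale1r scalerN -scaleNr sr mulN1r.
by rewrite oppr_ge0 leNgt => /negP.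
Qed.

End Positivstellensatz.
End QuadraticModules.

(** * Quadratic modules of polynomials *)

Section Polynomials.
Variables (R : realType) (d : nat).
Local Notation A := (polyring R d).
Implicit Types (p q : A) (x : 'rV[R]_d).

Lemma mpolyC_scale (c : R) : mpoly.mpolyC d c = c%:A :> A.
Proof. by rewrite mpoly.alg_mpolyC. Qed.

Lemma pevalD p q x : peval (p + q) x = peval p x + peval q x.
Proof. exact: mpoly.mevalD. Qed.

Lemma pevalB p q x : peval (p - q) x = peval p x - peval q x.
Proof. exact: mpoly.mevalB. Qed.

Lemma pevalN p x : peval (- p) x = - peval p x.
Proof. exact: mpoly.mevalN. Qed.

Lemma pevalM p q x : peval (p * q) x = peval p x * peval q x.
Proof. exact: mpoly.mevalM. Qed.

Lemma peval_scalar c x : peval c%:A x = c.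
Proof. by rewrite -mpolyC_scale; exact: mpoly.mevalC. Qed.

Lemma peval0 x : peval (0 : A) x = 0.
Proof. exact: mpoly.meval0. Qed.

Lemma pevalX (i : 'I_d) x : peval (mpoly.mpolyX R (mpoly.mnm1 i)) x = x ord0 i.
Proof. exact: mpoly.mevalXU. Qed.

Lemma peval1 x : peval (1 : A) x = 1.
Proof. exact: mpoly.meval1. Qed.

Lemma peval_linear (r : R) p q x :
  peval (r *: p + q) x = r * peval p x + peval q x.
Proof. by rewrite pevalD -mulr_algl pevalM peval_scalar. Qed.

Lemma poly_ind (P : A -> Prop) :
  (forall c : R, P c%:A) -> (forall i : 'I_d, P (mpoly.mpolyX R (mpoly.mnm1 i))) ->
  (forall p q, P p -> P q -> P (p + q)) ->
  (forall p q, P p -> P q -> P (p * q)) -> forall p, P p.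
Proof.
move=> PC PX PD PM p; elim/mpoly.mpolyind: p => [|c m p _ _ Pp].
  by rewrite -(scale0r 1).
apply: PD => //; rewrite -mulr_algl; apply: (PM) => //.
rewrite mpoly.mpolyXE_id; apply: (@big_ind _ P); [by rewrite -(scale1r 1)|exact: (PM)|].
move=> i _; elim: (mpoly.fun_of_multinom m i) => [|n IHn].
  by rewrite expr0 -(scale1r 1).
by rewrite exprS; apply: PM.
Qed.

(** A character of the polynomial ring is the evaluation at the point whose
coordinates are the images of the variables. *)
Lemma character_peval (s : A -> R) : character s ->
  exists x, forall p, s p = peval p x.
Proof.
move=> [sD sM sC].
exists (\row_i s (mpoly.mpolyX R (mpoly.mnm1 i))); apply: poly_ind => [c|i|p q|p q].
- by rewrite sC peval_scalar.
- by rewrite pevalX mxE.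
- by rewrite sD pevalD => -> ->.
- by rewrite sM pevalM => -> ->.
Qed.

Lemma continuous_peval p : continuous (peval p : 'rV[R]_d -> R).
Proof.
elim/poly_ind: p => [c|i|p q cp cq|p q cp cq] x.
- rewrite (_ : peval _ = cst c); first exact: cst_continuous.
  by apply/funext => y; rewrite peval_scalar.
- rewrite (_ : peval _ = fun y : 'rV[R]_d => y ord0 i); first exact: coord_continuous.
  by apply/funext => y; rewrite pevalX.
- rewrite (_ : peval _ = peval p \+ peval q); first exact: continuousD (cp x) (cq x).
  by apply/funext => y; rewrite pevalD.
- rewrite (_ : peval _ = peval p \* peval q); first exact: continuousM (cp x) (cq x).
  by apply/funext => y; rewrite pevalM.
Qed.

Section QuadraticModule.
Variables (k : nat) (f : 'I_k -> A).
Local Notation Q := (quadratic_module f).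
Local Notation K := (semialgebraic_set f).

Lemma quadratic_module_qmodule : qmodule Q.
Proof.
split; last first.
  exists 1, (fun=> 0); split=> [|i|].
  - by rewrite -(expr1n _ 2); exact: sos_sqr.
  - exact: sos0.
  - by rewrite big1 ?addr0// => i _; rewrite mulr0.
split=> [_ _ [s [t [ss st ->]]] [s' [t' [ss' st' ->]]]|
         _ _ [a ->] [s [t [ss st ->]]]].
  exists (s + s'), (fun i => t i + t' i); split; first exact: sosD.
    by move=> i; exact: sosD (st i) (st' i).
  by rewrite addrACA -big_split; congr (_ + _); apply: eq_bigr => i _; rewrite mulrDr.
exists (a ^+ 2 * s), (fun i => a ^+ 2 * t i); split; first exact: sosM.
  by move=> i; exact: sosM (st i).
rewrite mulrDr big_distrr; congr (_ + _); apply: eq_bigr => i _.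
by rewrite /= mulrCA.
Qed.

Lemma quadratic_module_gen i : Q (f i).
Proof.
exists 0, (fun j => if j == i then 1 else 0); split=> [|j|].
- exact: sos0.
- by case: eqP => _; [rewrite -(expr1n _ 2); exact: sos_sqr|exact: sos0].
- rewrite add0r (bigD1 i)//= eqxx mulr1 big1 ?addr0// => j /negbTE ->.
  by rewrite mulr0.
Qed.

Lemma peval_sos s x : sos s -> 0 <= peval s x.
Proof.
move=> [t ->]; apply: (big_ind (fun q => 0 <= peval q x)) => [|p q|p _].
- by rewrite peval0.
- by rewrite pevalD; exact: addr_ge0.
- by rewrite expr2 pevalM -expr2 sqr_ge0.
Qed.

Lemma peval_quadratic_module p x : Q p -> K x -> 0 <= peval p x.
Proof.
move=> [s [t [ss st ->]]] Kx; rewrite pevalD addr_ge0 ?(peval_sos _ ss)//.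
apply: (big_ind (fun q => 0 <= peval q x)) => [|q q'|i _].
- by rewrite peval0.
- by rewrite pevalD; exact: addr_ge0.
- by rewrite pevalM mulr_ge0//; exact: peval_sos (st i).
Qed.

Hypothesis Qarch : archimedean_qm Q.

Lemma quadratic_module_archimedean : archimedean Q.
Proof. by move=> a; have [l _] := Qarch a; rewrite mpolyC_scale; exists l. Qed.

(** Part (i): the characters that are nonnegative on Q are the evaluations at
points of K. *)
Theorem putinar h : (forall x, K x -> 0 < peval h x) -> Q h.
Proof.
move=> hK; apply: archimedean_positivstellensatz => //.
- exact: quadratic_module_qmodule.
- exact: quadratic_module_archimedean.
move=> s /character_peval[x sx] sQ; rewrite sx; apply: hK => i.
by rewrite -sx; apply/sQ/quadratic_module_gen.
Qed.

Lemma peval_bounded p : exists l, forall x, K x -> `|peval p x| <= l.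
Proof.
have [l1 Q1] := quadratic_module_archimedean p.
have [l2 Q2] := quadratic_module_archimedean (- p).
exists (Num.max l1 l2) => x Kx.
have := peval_quadratic_module Q1 Kx; have := peval_quadratic_module Q2 Kx.
rewrite !pevalB pevalN !peval_scalar !subr_ge0 => h2 h1.
by rewrite ler_norml lerNl !le_max h1 h2 orbT.
Qed.

Lemma closed_semialgebraic_set : closed K.
Proof.
have -> : K = \bigcap_(i in [set: 'I_k]) (peval (f i) @^-1` [set r | 0 <= r]).
  by apply/seteqP; split=> [x Kx i _|x Kx i]; [exact: Kx|exact: (Kx i I)].
apply: closed_bigI => i _; apply: (continuous_closedP _).1; last exact: closed_ge.
exact: continuous_peval.
Qed.

Lemma compact_semialgebraic_set : compact K.
Proof.
have /choice[l lP] (i : 'I_d) : exists l, forall x, K x -> `|x ord0 i| <= l.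
  have [l lP] := peval_bounded (mpoly.mpolyX R (mpoly.mnm1 i)).
  by exists l => x /lP; rewrite pevalX.
have box : compact [set x : 'rV[R]_d | forall i, `[- l i, l i]%classic (x ord0 i)].
  apply: (@rV_compact _ _ (fun i => `[- l i, l i]%classic)) => i.
  exact: segment_compact.
apply: subclosed_compact closed_semialgebraic_set box _ => x Kx i.
by rewrite /= in_itv/= -ler_norml lP.
Qed.

End QuadraticModule.
End Polynomials.

(** * Extension of positive functionals *)

Section PositiveExtension.
Variables (R : realType) (T : Type) (K : set T).
Implicit Types (g h : T -> R).

(** No condition outside K: functions are considered up to their values on K,
while keeping one function space on which the scalars act. *)
Definition bounded_on g := exists l : R, forall x, K x -> `|g x| <= l.

Lemma bounded_onD g h : bounded_on g -> bounded_on h -> bounded_on (g + h).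
Proof.
move=> [l gl] [m hm]; exists (l + m) => x Kx.
by rewrite (le_trans (ler_normD _ _))// lerD ?gl ?hm.
Qed.

Lemma bounded_onZ r g : bounded_on g -> bounded_on (r *: g).
Proof.
by move=> [l gl]; exists (`|r| * l) => x Kx; rewrite normrM ler_wpM2l// gl.
Qed.

Definition positive_functional (a : (T -> R) -> R) := [/\
  forall g h, bounded_on g -> bounded_on h -> a (g + h) = a g + a h,
  forall r g, bounded_on g -> a (r *: g) = r * a g &
  forall g, bounded_on g -> (forall x, K x -> 0 <= g x) -> 0 <= a g].

Variables (E : lmodType R) (ev : E -> T -> R) (e : E) (L : {scalar E}).
Hypotheses (evP : forall r p q x, ev (r *: p + q) x = r * ev p x + ev q x)
  (ev1 : forall x, ev e x = 1) (ev_bounded : forall p, bounded_on (ev p))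
  (Lpos : forall p, (forall x, K x -> 0 <= ev p x) -> 0 <= L p).

Let evD p q x : ev (p + q) x = ev p x + ev q x.
Proof. by rewrite -[p in LHS]scale1r evP mul1r. Qed.

Let ev0 x : ev 0 x = 0.
Proof. by apply: (addrI (ev 0 x)); rewrite -evD !addr0. Qed.

Let evZ r p x : ev (r *: p) x = r * ev p x.
Proof. by rewrite -[r *: p]addr0 evP ev0 addr0. Qed.

(** If L(e) > 0, then the positivity of L keeps -1 out of this cone. Both
p - L(p)/L(e) e and its negative have L-value 0, so every cone that contains
this one gives [ev p] the value L(p)/L(e). *)
Let dominating : set (T -> R) :=
  [set v | exists2 p, 0 <= L p & forall x, K x -> ev p x <= v x].

Let dominating_cone : cone dominating.
Proof.
split=> [v w [p Lp pv] [q Lq qw]|_ v [r r0 ->] [p Lp pv]].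
  exists (p + q); first by rewrite linearD addr_ge0.
  by move=> x Kx; rewrite evD lerD ?pv ?qw.
exists (r *: p); first by rewrite linearZ mulr_ge0.
by move=> x Kx; rewrite evZ ler_wpM2l// pv.
Qed.

(** M. Riesz's extension theorem, for the order unit e. *)
Theorem positive_extension :
  exists2 a, positive_functional a & forall p, a (ev p) = L p.
Proof.
have Le0 : 0 <= L e by apply: Lpos => x _; rewrite ev1.
(* If L(e) = 0, then L = 0 because every ev p lies between multiples of ev e. *)
move: Le0; rewrite le_eqVlt => /orP[/eqP Le0|Le0].
  exists (fun=> 0) => [|p].
    by split=> [||//] *; rewrite ?addr0 ?mulr0.
  have [l pl] := ev_bounded p.
  apply/esym/le_anti/andP; split.
    suff : 0 <= L (l *: e - p) by rewrite linearB linearZ/= -Le0 mulr0 sub0r oppr_ge0.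
    apply: Lpos => x Kx; rewrite -scaleN1r addrC evP evZ ev1 mulr1 mulN1r addrC subr_ge0.
    by rewrite (le_trans (ler_norm _))// pl.
  suff : 0 <= L (l *: e + p) by rewrite linearD linearZ/= -Le0 mulr0 add0r.
  apply: Lpos => x Kx; rewrite evP ev1 mulr1 -lerBlDl sub0r lerNl.
  by rewrite (le_trans (ler_norm _))// normrN pl.
pose u : T -> R := fun=> 1.
have d0 v : (forall x, K x -> 0 <= v x) -> dominating v.
  by move=> v0; exists 0; rewrite ?linear0// => x Kx; rewrite ev0 v0.
have dN1 : ~ dominating (- u).
  move=> [p Lp pN1].
  have : 0 <= L ((-1) *: p + (-1) *: e).
    apply: Lpos => x /pN1; rewrite evP evZ ev1 => pxN1.
    have {}pxN1 : ev p x <= - 1 := pxN1.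
    by lra.
  rewrite linearD !linearZ/=; lra.
have [C [dC Cc CN1 Cmax]] := exists_maximal_stable dominating_cone dN1.
have C0 v : (forall x, K x -> 0 <= v x) -> C v by move=> v0; exact/dC/d0.
have Cu : C u by apply: C0 => x _; exact: ler01.
have Ctot := maximal_cone_total Cc (C0 0 (fun _ _ => lexx _)) CN1 Cmax.
have uniq := cone_value_uniq Cc CN1.
have ex v : exists y, bounded_on v -> cone_value C u v y.
  have [[l vl]|nb] := pselect (bounded_on v); last by exists 0.
  have [||y vy] := cone_value_exists Cc Cu CN1 (v := v) (l := l) Ctot; last by exists y.
    apply: C0 => x Kx; suff : 0 <= l * 1 - v x by []; rewrite mulr1 subr_ge0.
    by rewrite (le_trans (ler_norm _))// vl.
  apply: C0 => x Kx; suff : 0 <= l * 1 + v x by []; rewrite mulr1 -lerBlDl sub0r lerNl.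
  by rewrite (le_trans (ler_norm _))// normrN vl.
have [s sP] := choice ex.
(* Values are normalized by s(u) = 1, whence the factor L(e). *)
exists (fun v => L e * s v); first split.
- move=> g h bg bh; rewrite -mulrDr; congr (_ * _); apply: (uniq (g + h)).
    exact/sP/bounded_onD.
  by apply: cone_valueD => //; exact: sP.
- move=> r g bg; rewrite mulrCA; congr (_ * _); apply: (uniq (r *: g)).
    exact/sP/bounded_onZ.
  by apply: cone_valueZ => //; exact: sP.
- move=> g bg g0; apply: mulr_ge0; first exact: ltW.
  by apply: (cone_value_ge0 Cc CN1 _ (sP _ bg)); exact: C0.
move=> p; have pV : cone_value C u (ev p) (L p / L e).
  have -> : ev p = (L p / L e) *: u + ev (p - (L p / L e) *: e).
    apply/funext => x; rewrite -scaleNr.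
    suff : ev p x = L p / L e * 1 + ev (p + (- (L p / L e)) *: e) x by [].
    by rewrite evD evZ ev1; ring.
  rewrite -[X in cone_value _ _ _ X]addr0 -[X in cone_value _ _ _ (X + _)]mulr1.
  apply: cone_valueD => //; first by apply: cone_valueZ => //; exact: cone_value_unit.
  have Lq : L (p - (L p / L e) *: e) = 0.
    by rewrite linearB linearZ/= divfK ?subrr// gt_eqF.
  apply: cone_value0 => //; apply: dC; first by exists (p - (L p / L e) *: e); rewrite ?Lq.
  exists (- (p - (L p / L e) *: e)); first by rewrite linearN Lq oppr0.
  by move=> x Kx; rewrite -scaleN1r evZ mulN1r.
rewrite (uniq _ _ _ (sP _ (ev_bounded p)) pV) mulrCA mulfV ?mulr1//.
by rewrite gt_eqF.
Qed.

End PositiveExtension.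

(** * Splitting a content along an interval *)

Section Walk.
Variables (T : pointedType) (R : realType) (m : set T -> R).
Implicit Types (B : nat -> set T) (C : set T) (a t : R) (n : nat) (x y : T).

(** The cell C, which owns the interval [a, a + m C[, is split by the first set
B 0: the part inside owns the left subinterval, the part outside the right one.
The walk follows t through n such splittings and returns the final cell. *)
Fixpoint walk B n C a t : set T :=
  if n is n'.+1 then
    if t < a + m (C `&` B 0%N) then walk (B \o S) n' (C `&` B 0%N) a t
    else walk (B \o S) n' (C `\` B 0%N) (a + m (C `&` B 0%N)) t
  else C.

Definition same_side B n x y := forall i, (i < n)%N -> B i x <-> B i y.

Lemma walk_sub B n C a t : walk B n C a t `<=` C.
Proof.
elim: n B C a => [|n IHn] B C a //=.
by case: ifP => _ x wx; case: (IHn _ _ _ x wx).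
Qed.

Lemma walk_anti B n C a t : walk B n.+1 C a t `<=` walk B n C a t.
Proof.
elim: n B C a => [|n IHn] B C a; first exact: walk_sub.
rewrite [walk B n.+2 _ _ _]/= [walk B n.+1 _ _ _]/=.
by case: (t < _); exact: IHn.
Qed.

Lemma walk_homo B n n' C a t : (n <= n')%N -> walk B n' C a t `<=` walk B n C a t.
Proof.
move=> /subnK <-; elim: (n' - n)%N => [|k IHk]; first by rewrite add0n.
by move=> x /walk_anti/IHk.
Qed.

Lemma walk_same_side B n C a t x y : walk B n C a t x -> walk B n C a t y ->
  same_side B n x y.
Proof.
elim: n B C a => [|n IHn] B C a //=; case: (t < _) => wx wy [|i] ltin.
- by have [_ Bx] := walk_sub wx; have [_ By] := walk_sub wy.
- exact: (IHn _ _ _ wx wy i).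
- by have [_ Bx] := walk_sub wx; have [_ By] := walk_sub wy.
- exact: (IHn _ _ _ wx wy i).
Qed.

Hypotheses (m0 : m set0 = 0)
  (mD : forall C D, m C = m (C `&` D) + m (C `\` D)).

(** A point t of the interval owned by C never enters an empty cell, whose
interval would have length 0. *)
Lemma walk_nonempty B n C a t : a <= t < a + m C -> walk B n C a t !=set0.
Proof.
elim: n B C a => [|n IHn] B C a /= /andP[at_ tm].
  apply/set0P/eqP => C0; move: tm; rewrite C0 m0 addr0.
  by rewrite ltNge at_.
case: ifP => [lt|/negbT]; first by apply: IHn; rewrite at_ lt.
by rewrite -leNgt => ge; apply: IHn; rewrite ge -addrA -mD.
Qed.

(** The walk is a step function of t, so every condition on the final cell,
without restriction, is measurable in t. *)
Lemma measurable_walk B n C a (P : set (set T)) :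
  measurable [set t : R | P (walk B n C a t)].
Proof.
elim: n B C a => [|n IHn] B C a /=.
  have [PC|nPC] := pselect (P C).
    by rewrite (_ : mkset _ = setT)//; apply/seteqP; split.
  by rewrite (_ : mkset _ = set0)//; apply/seteqP; split.
set c := a + _.
rewrite (_ : mkset _ =
  (`]-oo, c[ `&` [set t | P (walk (B \o S) n (C `&` B 0%N) a t)]) `|`
  (`[c, +oo[ `&` [set t | P (walk (B \o S) n (C `\` B 0%N) c t)])).
  by apply: measurableU; apply: measurableI => //; exact: IHn.
apply/seteqP; split=> t /=; rewrite !in_itv/= ?andbT; have [tc|ct] := ltP t c.
- by left.
- by right.
- by case=> -[].
- by case=> -[].
Qed.

End Walk.

Section WalkIntegral.
Variables (T : pointedType) (R : realType) (K : set T) (alpha : (T -> R) -> R).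
Hypothesis alphaP : positive_functional K alpha.
Implicit Types (g h : T -> R) (C : set T) (B : nat -> set T) (a : R).
Local Notation bounded := (@bounded_on R T K).
Local Notation mu := (@lebesgue_measure R).

Let alphaD g h : bounded g -> bounded h -> alpha (g + h) = alpha g + alpha h.
Proof. by case: alphaP => + _ _; apply. Qed.

Let alphaZ r g : bounded g -> alpha (r *: g) = r * alpha g.
Proof. by case: alphaP => _ + _; apply. Qed.

Let alpha_ge0 g : bounded g -> (forall x, K x -> 0 <= g x) -> 0 <= alpha g.
Proof. by case: alphaP => _ _; apply. Qed.

Lemma positive_functional_le g h : bounded g -> bounded h ->
  (forall x, K x -> g x <= h x) -> alpha g <= alpha h.
Proof.
move=> bg bh gh; rewrite -subr_ge0.
have bNg : bounded (-1 *: g) by exact: bounded_onZ.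
rewrite -mulN1r -alphaZ// -alphaD//; apply: alpha_ge0; first exact: bounded_onD.
by move=> x Kx; rewrite fctE scaleN1r subr_ge0 gh.
Qed.

Lemma bounded_indic C : bounded (\1_C : T -> R).
Proof. by exists 1 => x _; rewrite indicE; case: (x \in C); rewrite ?normr1 ?normr0. Qed.

Lemma bounded_onM g h : bounded g -> bounded h -> bounded (g \* h).
Proof.
by move=> [l gl] [k hk]; exists (l * k) => x Kx; rewrite normrM ler_pM ?gl ?hk.
Qed.

(** A finitely additive mass defined on all subsets of T. *)
Definition content C : R := alpha \1_C.

Lemma content_ge0 C : 0 <= content C.
Proof.
by apply: alpha_ge0 => [|x _]; [exact: bounded_indic|rewrite indicE].
Qed.

Lemma content0 : content set0 = 0.
Proof.
have -> : content set0 = alpha (0 *: cst 0).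
  by congr alpha; apply/funext => x; rewrite indic0; exact/esym/mul0r.
by rewrite alphaZ ?mul0r//; exists 0 => x _; rewrite normr0.
Qed.

Lemma positive_functional_split g C D : bounded g ->
  alpha (\1_C \* g) = alpha (\1_(C `&` D) \* g) + alpha (\1_(C `\` D) \* g).
Proof.
move=> bg; rewrite -alphaD; [|exact/bounded_onM/bg/bounded_indic..].
congr alpha; apply/funext => x.
suff : \1_C x * g x = \1_(C `&` D) x * g x + \1_(C `\` D) x * g x by [].
rewrite !indicE in_setI in_setD -mulrDl.
by congr (_ * _); case: (x \in C); case: (x \in D); rewrite /= ?addr0 ?add0r.
Qed.

Lemma contentD C D : content C = content (C `&` D) + content (C `\` D).
Proof.
have M1 F : content F = alpha (\1_F \* cst 1).
  by congr alpha; apply/funext => x /=; rewrite mulr1.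
rewrite !M1; apply: positive_functional_split.
by exists 1 => x _; rewrite normr1.
Qed.

Lemma lebesgue_measure_content C a :
  mu `[a, a + content C[ = (content C)%:E.
Proof.
rewrite lebesgue_measure_itv/= lte_fin ltrDl -EFinB (addrC a) addrK.
have := content_ge0 C; rewrite le_eqVlt => /orP[/eqP <-|->//].
by rewrite ltxx.
Qed.

Lemma measurable_walk_point (g : T -> R) B n C a (D : set R) : measurable D ->
  measurable_fun D (fun t => g (get (walk content B n C a t))).
Proof.
move=> mD _ Y mY; apply: measurableI => //.
exact: (measurable_walk content B n C a [set W | Y (g (get W))]).
Qed.

Lemma integrable_walk_point (g : T -> R) B n C a (b c : R) : bounded g -> C `<=` K ->
  mu.-integrable `[b, c[ (EFin \o (fun t => g (get (walk content B n C a t)))).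
Proof.
move=> [l gl] CK; apply: measurable_bounded_integrable => //=.
- by rewrite lebesgue_measure_itv/=; case: ifP => _; rewrite -?EFinD ltry.
- exact: measurable_walk_point.
exists (Num.max l `|g point|); split=> [|r lr t _] /=; first exact: num_real.
apply/ltW; apply: le_lt_trans lr; rewrite le_max.
have [W0|W0] := pselect (walk content B n C a t !=set0).
  by have /CK/gl -> := walk_sub (getPex W0).
by rewrite getPN ?lexx ?orbT// => y Wy; apply: W0; exists y.
Qed.

(** The final cells have the same mass for alpha as for Lebesgue measure, and
on each of them g differs by at most eps from its value at the chosen point; so
the integral of the step function and alpha(g) differ by at most eps times the
total mass. *)
Lemma integral_walk (g : T -> R) (eps : R) B n C a : bounded g -> C `<=` K ->
  (forall x y, C x -> C y -> same_side B n x y -> `|g x - g y| <= eps) ->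
  `|\int[mu]_(t in `[a, a + content C[) g (get (walk content B n C a t))
    - alpha (\1_C \* g)| <= eps * content C.
Proof.
move=> bg; elim: n B C a => [|n IHn] B C a CK osc /=.
  rewrite Rintegral_cst//= lebesgue_measure_content/=.
  have b1 c : bounded (c *: \1_C : T -> R) by apply/bounded_onZ/bounded_indic.
  have bC : bounded (\1_C \* g) by exact/bounded_onM/bg/bounded_indic.
  rewrite ler_distlC -!mulrDl -mulrBl /content -!alphaZ; try exact: bounded_indic.
  have near x : C x -> g (get C) - eps <= g x <= g (get C) + eps.
    by move=> Cx; rewrite -ler_distlC osc//; apply: getPex; exists x.
  apply/andP; split; apply: positive_functional_le => // x _.
    suff : (g (get C) - eps) * \1_C x <= \1_C x * g x by [].
    rewrite indicE; case: (boolP (x \in C)) => [/set_mem/near/andP[lo _]|_].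
      by rewrite mulr1 mul1r.
    by rewrite mulr0 mul0r.
  suff : \1_C x * g x <= (g (get C) + eps) * \1_C x by [].
  rewrite indicE; case: (boolP (x \in C)) => [/set_mem/near/andP[_ hi]|_].
    by rewrite mulr1 mul1r.
  by rewrite mulr0 mul0r.
set C1 := C `&` B 0%N; set C2 := C `\` B 0%N; set c := a + content C1.
have ac : a <= c by rewrite lerDl content_ge0.
have cb : c <= c + content C2 by rewrite lerDl content_ge0.
have bE : a + content C = c + content C2 by rewrite (contentD C (B 0%N)) addrA.
have itvU : [set` `[a, a + content C[] = [set` `[a, c[] `|` [set` `[c, c + content C2[].
  by rewrite bE -itv_bndbnd_setU// bnd_simp.
rewrite itvU (positive_functional_split C (B 0%N) bg) (contentD C (B 0%N)).
rewrite -/C1 -/C2 Rintegral_setU//=; last 2 first.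
- rewrite -itvU; exact: (@integrable_walk_point g B n.+1 C a).
- apply/disj_setPS => t [/=]; rewrite !in_itv/= => /andP[_ tc] /andP[].
  by rewrite leNgt tc.
rewrite (@eq_Rintegral _ _ _ mu [set` `[a, c[]
    (fun t => g (get (walk content (B \o S) n C1 a t)))); last first.
  by move=> t /set_mem/=; rewrite in_itv/= => /andP[_ ->].
rewrite (@eq_Rintegral _ _ _ mu [set` `[c, c + content C2[]
    (fun t => g (get (walk content (B \o S) n C2 c t)))); last first.
  by move=> t /set_mem/=; rewrite in_itv/= => /andP[ct _]; rewrite ltNge ct.
rewrite opprD addrACA mulrDr (le_trans (ler_normD _ _))// lerD//; apply: IHn.
- by move=> x [/CK].
- move=> x y [Cx Bx] [Cy By] xy; apply: osc => // -[|i] lti; first by split.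
  exact: xy.
- by move=> x [/CK].
- move=> x y [Cx Bx] [Cy By] xy; apply: osc => // -[|i] lti; first by split.
  exact: xy.
Qed.

End WalkIntegral.

(** * Uniform separation and continuity on compact sets *)

Section CompactTests.
Variables (R : realType) (T : normedModType R) (K : set T).
Hypothesis Kc : compact K.
Implicit Types (x y : T).

Lemma compact_finite_net (e : R) : 0 < e ->
  exists s : seq T, forall x, K x -> exists2 i, (i < size s)%N & `|s`_i - x| < e.
Proof.
move=> e0; have := Kc; rewrite compact_cover => /(_ T setT (fun c => ball c e)).
case=> [c _|x _|D _ KD]; first exact: ball_open.
  by exists x => //; exact: ballxx.
exists (finmap.enum_fset D) => x /KD[c /= cD]; rewrite -ball_normE => cx.
by exists (index c (finmap.enum_fset D)); rewrite ?index_mem// nth_index.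
Qed.

Lemma natSinv_lt (e : R) : 0 < e -> exists n : nat, n.+1%:R^-1 < e.
Proof.
move=> e0; have [n _ /(_ n (leqnn n)) nP] := near_infty_natSinv_lt (PosNum e0).
by exists n.
Qed.

(** The sets B n enumerate, for every i, the finitely many balls of radius
1/(i+1) of a cover of K. Two points on the same side of all balls of one cover
lie in a common ball. *)
Lemma compact_separating_tests : exists B : nat -> set T, forall e : R, 0 < e ->
  exists N, forall x y, K x -> K y -> same_side B N x y -> `|x - y| < e.
Proof.
have /choice[s sP] (n : nat) := @compact_finite_net n.+1%:R^-1 ltac:(by rewrite invr_gt0).
pose B n : set T := if unpickle n is Some (i, j) then
  [set x | `|(s i)`_j - x| < i.+1%:R^-1] else set0.
exists B => e e0; have [n ne] := natSinv_lt (divr_gt0 e0 (ltr0n _ 2)).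
(* Past this index, all balls of the n-th cover have been enumerated. *)
exists (\max_(j < size (s n)) (pickle (n, val j)).+1)%N => x y Kx Ky xy.
have [j js jx] := sP n x Kx.
have jy : `|(s n)`_j - y| < n.+1%:R^-1.
  have := xy (pickle (n, j)); rewrite /B pickleK => -[|+ _]; last exact.
  exact: (@leq_bigmax _ (fun j : 'I_(size (s n)) => (pickle (n, val j)).+1) (Ordinal js)).
have -> : x - y = ((s n)`_j - y) - ((s n)`_j - x) by rewrite opprB [RHS]addrC addrA subrK.
rewrite (le_lt_trans (ler_normB _ _))// (splitr e) ltrD//.
  exact: lt_trans ne.
exact: lt_trans ne.
Qed.

Lemma compact_unif_continuous (g : T -> R) (e : R) : continuous g -> 0 < e ->
  exists2 r : R, 0 < r &
    forall x y, K x -> K y -> `|x - y| < r -> `|g x - g y| < e.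
Proof.
move=> gc e0; have e2 : 0 < e / 2 by rewrite divr_gt0.
have := (compact_near_coveringP K).1 Kc R (0^'+)
  (fun r x => forall y, `|x - y| < r -> `|g x - g y| < e) _.
case=> [x Kx|].
  have /cvgrPdist_lt/(_ _ e2)/nbhs_ballP[r /= r0 rP] := gc x.
  have r2 : 0 < r / 2 by rewrite divr_gt0.
  exists (ball x (r / 2), [set t | t < r / 2]); first split => /=.
  - exact: nbhsx_ballx.
  - exact: nbhs_right_lt.
  move=> [x' t] /= []; rewrite -ball_normE/= => xx' tr y x'y.
  rewrite -(subrKA (g x)) (le_lt_trans (ler_normD _ _))// (splitr e) ltrD//.
    rewrite distrC; apply: rP; rewrite -ball_normE/= (lt_trans xx')//.
    by rewrite ltr_pdivrMr// ltr_pMr// ltr1n.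
  apply: rP; rewrite -ball_normE/= -(subrKA x') (le_lt_trans (ler_normD _ _))//.
  by rewrite (splitr r) ltrD// (lt_trans x'y).
move=> r /= r0 rP; exists (r / 2); first by rewrite divr_gt0.
move=> x y Kx Ky xy; apply: (rP (r / 2)) => //=.
- by rewrite sub0r normrN gtr0_norm ?divr_gt0// ltr_pdivrMr// ltr_pMr// ltr1n.
- by rewrite divr_gt0.
Qed.

Lemma continuous_bounded_on (g : T -> R) : continuous g -> bounded_on K g.
Proof.
move=> gc; have /compact_bounded[l [_ lP]] : compact (g @` K).
  by apply: continuous_compact => //; exact: continuous_subspaceT.
exists (l + 1) => x Kx; apply: (lP (l + 1)); first by rewrite ltrDl.
by exists x.
Qed.

End CompactTests.

(** * The representing map *)

Section RepresentingMap.
Variables (R : realType) (T : normedModType R) (K : set T).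
Variable alpha : (T -> R) -> R.
Hypotheses (Kc : compact K) (alphaP : positive_functional K alpha).
Local Notation mu := (@lebesgue_measure R).
Local Notation m := (content alpha).
Local Notation I := ([set` `[(0 : R), 0 + m K[]).

(** The chosen points of the successive cells of t form a Cauchy sequence,
uniformly in t, because the cells decrease and their points are not separated
by the tests already used. The limit X t belongs to K by compactness. *)
Lemma exists_representing_map : exists (B : nat -> set T) (X : R -> T),
  [/\ forall t, I t -> K (X t),
      forall t, ~ I t -> X t = point,
      forall e : R, 0 < e -> exists N, forall x y, K x -> K y ->
        same_side B N x y -> `|x - y| < e &
      forall e : R, 0 < e -> exists N, forall n t, (N <= n)%N -> I t ->
        `|X t - get (walk m B n K 0 t)| <= e].
Proof.
have [B Bsep] := compact_separating_tests Kc.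
pose W n t := walk m B n K 0 t; pose p n t := get (W n t).
have Wp n t : I t -> W n t (p n t).
  rewrite /= in_itv/= => It; have [x Wx] : W n t !=set0.
    exact: walk_nonempty (content0 alphaP) (contentD alphaP) _ _ _ _ _ It.
  by apply: getPex; exists x.
have Kp n t : I t -> K (p n t) by move=> /(Wp n)/walk_sub.
have pp e : 0 < e -> exists N, forall n n' t, (N <= n)%N -> (N <= n')%N -> I t ->
    `|p n t - p n' t| < e.
  move=> /Bsep[N NP]; exists N => n n' t Nn Nn' It; apply: NP; [exact: Kp..|].
  by apply: walk_same_side; [exact/(walk_homo Nn)/Wp|exact/(walk_homo Nn')/Wp].
have pX t : exists x : T, (I t -> (fun n => p n t) @ \oo --> x) /\ (~ I t -> x = point).
  have [It|nIt] := pselect (I t); last by exists point.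
  exists (lim ((fun n => p n t) @ \oo)); split=> // _.
  apply: (compact_cauchy_cvg _ _ _ Kc); last by exists 0%N => // n _; exact: Kp.
  apply/cauchy_exP => e /pp[N NP]; exists (p N t); exists N => // n /= Nn.
  by rewrite -ball_normE/=; exact: NP.
have [X XP] := choice pX.
exists B, X; split=> [t It|t nIt|//|e e0].
- have Kcl : closed K by apply: compact_closed => //; exact: norm_hausdorff.
  apply: (closed_cvg _ Kcl _ (X t) ((XP t).1 It)).
  by apply: nearW => n; exact: Kp.
- exact: (XP t).2.
- have [N NP] := pp _ e0; exists N => n t Nn It.
  rewrite distrC.
  apply: (closed_cvg (fun x => `|p n t - x| <= e) _ _ (X t) ((XP t).1 It)).
    exact: (@closed_closed_ball_ R T (p n t) e).
  by exists N => // n' Nn'; exact/ltW/NP.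
Qed.

End RepresentingMap.

(** * The representing measure *)

Section RestrictedIntegral.
Variables (d : measure_display) (X : measurableType d) (R : realType).
Variables (mu : {measure set X -> \bar R}) (D : set X) (mD : measurable D).
Local Open Scope ereal_scope.

Lemma integral_mrestr (f : X -> \bar R) : (mrestr mu mD).-integrable setT f ->
  \int[mrestr mu mD]_x f x = \int[mu]_(x in D) f x.
Proof.
move=> intf; rewrite (@negligible_integral _ _ _ (mrestr mu mD) setT (~` D))//=;
  last 2 first.
- exact: measurableC.
- by rewrite /mrestr setICl measure0.
rewrite setTD setCK; apply: eq_measure_integral => A mA AD.
by rewrite /= /mrestr setIidl.
Qed.

End RestrictedIntegral.

Section BorelOfContinuous.
Variables (R : realType) (T : ptopologicalType).

Lemma continuous_borel_measurable (g : T -> R) : continuous g ->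
  measurable_fun [set: g_sigma_algebraType (@open T)] g.
Proof.
move=> gc; apply: (measurability _ (RGenOInfty.measurableE R)) => /=.
move=> _ [_ [x ->] <-]; rewrite setTI; apply: sub_sigma_algebra.
by move/continuousP : gc; apply; exact: interval_open.
Qed.

End BorelOfContinuous.

Section RepresentingMeasure.
Variables (R : realType) (T : normedModType R) (K : set T).
Variable alpha : (T -> R) -> R.
Hypotheses (Kc : compact K) (alphaP : positive_functional K alpha).
Local Notation mu := (@lebesgue_measure R).
Local Notation m := (content alpha).
Local Notation I := ([set` `[(0 : R), 0 + m K[]).
Local Notation borel := (g_sigma_algebraType (@open T)).

(** X is a uniform limit of step functions p_n, and for U open, X t is in U
exactly when, for some i, the balls of radius 1/(i+1) around p_n t are
eventually contained in U. This avoids any separability of T: the sets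
of all t with such a condition on p_n t are measurable anyway. *)
Lemma measurable_walk_limit (B : nat -> set T) (X : R -> T) :
  (forall t, ~ I t -> X t = point) ->
  (forall e : R, 0 < e -> exists N, forall n t, (N <= n)%N -> I t ->
    `|X t - get (walk m B n K 0 t)| <= e) ->
  measurable_fun [set: measurableTypeR R] (X : R -> borel).
Proof.
move=> XnI Xlim.
apply: (@measurability _ _ (measurableTypeR R) borel setT X (@open T) erefl).
move=> _ [U oU <-].
rewrite setTI; pose near_in i N n := [set t | (N <= n)%N ->
  ball (get (walk m B n K 0 t)) i.+1%:R^-1 `<=` U].
have -> : X @^-1` U = (~` I `&` [set t | U point]) `|`
    (I `&` \bigcup_i \bigcup_N \bigcap_n near_in i N n).
  apply/seteqP; split=> t /=.
  - move=> UX; have [It|nIt] := pselect (I t); last first.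
      by left; split=> //; rewrite -(XnI t nIt).
    right; split=> //.
    have /nbhs_ballP[e /= e0 eU] : nbhs (X t) U by exact: open_nbhs_nbhs.
    have [i ie] := natSinv_lt (divr_gt0 e0 (ltr0n _ 2)).
    have [N NP] := Xlim (e / 2) (divr_gt0 e0 (ltr0n _ 2)).
    exists i => //; exists N => // n _ Nn y; rewrite -ball_normE/= => py.
    apply: eU; rewrite -ball_normE/= (splitr e) -(subrKA (get (walk m B n K 0 t))).
    rewrite (le_lt_trans (ler_normD _ _))// ler_ltD//; first exact: NP.
    exact: lt_trans ie.
  - move=> [[nIt Up]|[It [i _ [N _ NP]]]]; first by rewrite (XnI t nIt).
    have i0 : 0 < i.+1%:R^-1 / 2 :> R by rewrite divr_gt0.
    have [N' N'P] := Xlim _ i0.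
    apply: (NP (maxn N N')) => //; first exact: leq_maxl.
    rewrite -ball_normE/= distrC (le_lt_trans (N'P _ _ _ _))//; first exact: leq_maxr.
    by rewrite ltr_pdivrMr// ltr_pMr// ltr1n.
apply: measurableU.
  apply: measurableI; first exact: measurableC.
  have [Up|nUp] := pselect (U point).
    by rewrite (_ : mkset _ = setT)//; apply/seteqP; split.
  by rewrite (_ : mkset _ = set0)//; apply/seteqP; split.
apply: measurableI => //; apply: bigcupT_measurable => i.
apply: bigcupT_measurable => N; apply: bigcapT_measurable => n.
exact: (measurable_walk m B n K 0
  [set W | (N <= n)%N -> ball (get W) i.+1%:R^-1 `<=` U]).
Qed.

(** A Riesz representation theorem on a compact set, for functionals already
defined on all bounded functions. *)
Theorem compact_representing_measure :
  exists nu : {measure set borel -> \bar R}, [/\ (nu setT < +oo)%E,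
    nu (~` K) = 0%E & forall g : T -> R, continuous g ->
      nu.-integrable setT (EFin \o g) /\ (alpha g)%:E = (\int[nu]_x (g x)%:E)%E].
Proof.
have [B [X [XK XnI Bsep Xlim]]] := exists_representing_map Kc alphaP.
have mX := measurable_walk_limit XnI Xlim.
have mI : measurable (I : set (measurableTypeR R)) by [].
pose nu0 : {measure set (measurableTypeR R) -> \bar R} := mrestr mu mI.
have nuT : (nu0 setT = (m K)%:E)%E.
  by rewrite /nu0/= /mrestr setTI; exact: (lebesgue_measure_content alphaP).
exists (measure_function_pushforward__canonical__measure_function_Measure nu0 mX).
split => /=.
- by rewrite /pushforward preimage_setT nuT ltry.
- rewrite /pushforward /nu0/= /mrestr (_ : _ `&` _ = set0) ?measure0//.
  by apply/seteqP; split=> // t [/= nK /XK].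
move=> g gc.
pose p n t := get (walk m B n K 0 t).
have [l gl] := continuous_bounded_on Kc gc.
have mgX : measurable_fun [set: measurableTypeR R] (g \o X).
  apply: (measurableT_comp _ mX); exact: continuous_borel_measurable.
have gXint : nu0.-integrable setT (EFin \o (g \o X)).
  apply: measurable_bounded_integrable => //.
    by rewrite [X in (X < _)%E]nuT ltry.
  exists (Num.max l `|g point|); split=> [|r lr t _] /=; first exact: num_real.
  apply/ltW; apply: le_lt_trans lr; rewrite le_max.
  have [/XK/gl -> //|nIt] := pselect (I t).
  by rewrite (XnI t nIt) lexx orbT.
have gint : (pushforward nu0 (X : _ -> borel)).-integrable setT (EFin \o g).
  apply: integrable_pushforward => //.
  by apply/measurable_EFinP; exact: continuous_borel_measurable.
split=> //.
rewrite integral_pushforward//; last first.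
  by apply/measurable_EFinP; exact: continuous_borel_measurable.
rewrite preimage_setT integral_mrestr//.
have gXI : mu.-integrable I (EFin \o (g \o X)).
  apply: measurable_bounded_integrable => //.
  - by rewrite [X in (X < _)%E](lebesgue_measure_content alphaP) ltry.
  - exact: measurable_funTS.
  - exists l; split=> [|r lr t It] /=; first exact: num_real.
    by rewrite (le_trans (gl _ (XK _ It)))// ltW.
rewrite -[RHS]fineK; last exact: integrable_fin_num.
congr EFin; apply/eqP; rewrite eq_sym -subr_eq0 -normr_le0; apply/ler_addgt0Pr => e0 e00.
have mK0 : 0 <= m K := content_ge0 alphaP K.
(* Two errors of size e * m K occur below: from X to the step function, and from
the step function to alpha. *)
pose e := e0 / (2 * m K + 1).
have e_gt0 : 0 < e by rewrite divr_gt0// ltr_wpDl// mulr_ge0.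
have [r r0 rP] := compact_unif_continuous Kc gc e_gt0.
have [N1 N1P] := Bsep _ r0.
have [N2 N2P] := Xlim _ (divr_gt0 r0 (ltr0n _ 2)).
pose N := maxn N1 N2.
have Kp t : I t -> K (p N t).
  rewrite /= in_itv/= => It; have [x Wx] : walk m B N K 0 t !=set0.
    exact: walk_nonempty (content0 alphaP) (contentD alphaP) _ _ _ _ _ It.
  by apply: walk_sub; apply: getPex; exists x.
have gbd : bounded_on K g by exists l.
have intW : mu.-integrable I (EFin \o (fun t => g (p N t))).
  exact: integrable_walk_point _ _ _ _ _ _ gbd (@subset_refl _ K).
(* The function alpha ignores the values of g outside K. *)
have alphaK : alpha g = alpha (\1_K \* g).
  have b1 : bounded_on K (\1_K \* g) by exact/bounded_onM/gbd/bounded_indic.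
  have gE x : K x -> (\1_K \* g) x = g x.
    by move=> Kx; rewrite /= indicE mem_set// mul1r.
  by apply/le_anti/andP; split; apply: (positive_functional_le alphaP) => // x /gE ->.
have walkI : `|\int[mu]_(t in I) g (p N t) - alpha g| <= e * m K.
  rewrite alphaK; apply: (@integral_walk T R K alpha alphaP g e B N K 0 gbd
    (@subset_refl _ K)) => x y Kx Ky xy.
  apply/ltW/rP => //; apply: N1P => // i lti; apply: xy.
  by rewrite (leq_trans lti)// leq_maxl.
have limI : `|\int[mu]_(t in I) g (X t) - \int[mu]_(t in I) g (p N t)| <= e * m K.
  have intD : mu.-integrable I (EFin \o (fun t => g (X t) - g (p N t))).
    exact: (integrableB mI gXI intW).
  rewrite -RintegralB// (le_trans (le_normr_Rintegral _ _))//.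
  have -> : e * m K = \int[mu]_(t in I) e.
    by rewrite Rintegral_cst// [X in fine X](lebesgue_measure_content alphaP).
  apply: le_Rintegral => //.
  - exact: integrable_norm intD.
  - apply: measurable_bounded_integrable => //.
      by rewrite [X in (X < _)%E](lebesgue_measure_content alphaP) ltry.
    by exists e; split=> [|b eb t _] /=; [exact: num_real|rewrite gtr0_norm// ltW].
  move=> t It; apply/ltW/rP; [exact: XK|exact: Kp|].
  rewrite (le_lt_trans (N2P N t _ It)) ?leq_maxr//.
  by rewrite ltr_pdivrMr// ltr_pMr// ltr1n.
rewrite [leRHS]add0r -[X in `|X - _|]/(\int[mu]_(t in I) g (X t)).
rewrite -(subrKA (\int[mu]_(t in I) g (p N t))) (le_trans (ler_normD _ _))//.
rewrite (le_trans (lerD limI walkI))// -mulrDr /e mulrAC ler_pdivrMr.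
  by rewrite ler_wpM2l ?ltW// mulr2n mulrDl mul1r; lra.
by rewrite ltr_wpDl// mulr_ge0.
Qed.

End RepresentingMeasure.

(** * Inner regularity of finite Borel measures *)

Section ClosedInnerRegularity.
Variables (R : realType) (T : normedModType R).
Local Notation borel := (g_sigma_algebraType (@open T)).
Variable nu : {measure set borel -> \bar R}.
Hypothesis nufin : (nu setT < +oo)%E.
Local Open Scope ereal_scope.

Lemma open_borel (U : set T) : open U -> measurable (U : set borel).
Proof. by move=> oU; exact: sub_sigma_algebra. Qed.

Lemma closed_borel (F : set T) : closed F -> measurable (F : set borel).
Proof. by rewrite -openC => /open_borel/measurableC; rewrite setCK. Qed.

(** For sets A and complements that both have this property, it passes to
countable unions and intersections, so that they form a sigma-algebra. *)
Definition closed_approximable (A : set T) := forall e : R, (0 < e)%R ->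
  exists F : set T, [/\ closed F, F `<=` A & nu (A `\` F) <= e%:E].

Lemma closed_approximable_closed (F : set T) : closed F -> closed_approximable F.
Proof.
by move=> cF e e0; exists F; split; [|exact: subset_refl|rewrite setDv measure0 lee_fin ltW].
Qed.

Lemma closed_approximable_seq (A : nat -> set borel) (e : R) :
  (forall n, measurable (A n)) -> (forall n, closed_approximable (A n)) ->
  (0 < e)%R -> exists F : nat -> set T, [/\ forall n, closed (F n),
    forall n, F n `<=` A n & nu (\bigcup_n (A n `\` F n)) <= e%:E].
Proof.
move=> mA aA e0.
have en n : (0 < e / (2 ^ n.+1)%:R)%R by rewrite divr_gt0// ltr0n expn_gt0.
have /choice[F FP] n := aA n _ (en n).
have mAF n : measurable (A n `\` F n : set borel).
  by apply: measurableD => //; have [+ _ _] := FP n; exact: closed_borel.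
exists F; split=> [n|n|]; [by have [? _ _] := FP n|by have [_ ? _] := FP n|].
apply: le_trans (epsilon_trick0 xpredT (ltW e0)).
apply: (@le_trans _ _ (\sum_(n <oo) nu (A n `\` F n))).
  by apply: measure_sigma_subadditive => //; exact: bigcupT_measurable.
by apply: lee_nneseries => // n _; have [_ _ ?] := FP n.
Qed.

Lemma closed_approximable_bigcap (A : nat -> set borel) :
  (forall n, measurable (A n)) -> (forall n, closed_approximable (A n)) ->
  closed_approximable (\bigcap_n A n).
Proof.
move=> mA aA e e0; have [F [cF FA nuF]] := closed_approximable_seq mA aA e0.
have mF n : measurable (F n : set borel) by exact: closed_borel.
exists (\bigcap_n F n); split; first by apply: closed_bigI => n _.
  by move=> x Fx n _; exact/FA/Fx.
apply: le_trans nuF; apply: le_measure; rewrite ?inE.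
- by apply: measurableD; exact: bigcapT_measurable.
- by apply: bigcupT_measurable => n; exact: measurableD.
move=> x [Ax /existsNP[n /not_implyP[_ nFx]]].
by exists n => //; split=> //; exact: Ax.
Qed.

Lemma closed_approximable_bigcup (A : nat -> set borel) :
  (forall n, measurable (A n)) -> (forall n, closed_approximable (A n)) ->
  closed_approximable (\bigcup_n A n).
Proof.
move=> mA aA e e0; have e2 : (0 < e / 2)%R by rewrite divr_gt0.
have [F [cF FA nuF]] := closed_approximable_seq mA aA e2.
have mF n : measurable (F n : set borel) by exact: closed_borel.
pose G N : set borel := \bigcup_(n in `I_N) F n.
have cG N : closed (G N : set T) by apply: closed_bigcup => // n _.
pose D N : set borel := \bigcup_n A n `\` G N.
have mUA : measurable (\bigcup_n A n) by exact: bigcupT_measurable.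
have mD N : measurable (D N) by apply: measurableD => //; exact: closed_borel.
have nuD0 : nu (D 0%N) < +oo by rewrite (le_lt_trans _ nufin)// le_measure ?inE.
have Dni : nonincreasing_seq D.
  move=> N N' NN'; apply/subsetPset => x [Ax nG]; split=> // -[n /= nN Fx].
  by apply: nG; exists n => //=; exact: leq_trans NN'.
have mcapD : measurable (\bigcap_N D N) by exact: bigcapT_measurable.
(* The sets F n are too many for their union to be closed: finitely many of them
suffice, by continuity of nu along the decreasing differences D N. *)
have Dcvg := nonincreasing_cvg_mu nuD0 mD mcapD Dni.
have nucap : nu (\bigcap_N D N) < e%:E.
  rewrite (@le_lt_trans _ _ (e / 2)%:E) ?lte_fin ?ltr_pdivrMr ?ltr_pMr ?ltr1n//.
  apply: le_trans nuF; apply: le_measure; rewrite ?inE//.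
    by apply: bigcupT_measurable => n; exact: measurableD.
  move=> x Dx; have [[n _ Anx] _] := Dx 0%N I; exists n => //; split=> // Fnx.
  by have [_] := Dx n.+1 I; apply; exists n => //=.
have [N _ /(_ N (leqnn N))/= nuDN] : \forall N \near \oo, nu (D N) < e%:E.
  exact: (Dcvg _ (open_ereal_lt' nucap)).
exists (G N); split => //; last exact: ltW.
by move=> x [n _ /FA Ax]; exists n.
Qed.

(** The n-th closed set consists of the points at distance at least 1/(n+1)
from the complement of U. *)
Lemma open_bigcup_closed (U : set T) : open U ->
  exists F : nat -> set T, (forall n, closed (F n)) /\ U = \bigcup_n F n.
Proof.
move=> oU; exists (fun n => ~` \bigcup_(y in ~` U) ball y n.+1%:R^-1); split.
  by move=> n; apply: open_closedC; apply: bigcup_open => y _; exact: ball_open.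
apply/seteqP; split=> [x Ux|x [n _ nB]]; last first.
  by apply: contrapT => nUx; apply: nB; exists x => //; exact: ballxx.
have /nbhs_ballP[e /= e0 eU] : nbhs x U by exact: open_nbhs_nbhs.
have [n ne] := natSinv_lt e0; exists n => // -[y nUy]; rewrite -ball_normE/= => yx.
by apply: nUy; apply: eU; rewrite -ball_normE/= distrC (lt_trans yx).
Qed.

Theorem borel_closed_approximable (A : set borel) : measurable A ->
  closed_approximable A.
Proof.
pose G : set (set T) := [set A | [/\ measurable (A : set borel),
  closed_approximable A & closed_approximable (~` A)]].
suff sG : <<s (@open T) >> `<=` G by move=> mA; have [_ + _] := sG _ mA.
apply: smallest_sub; last first.
  move=> U oU; split; first exact: open_borel.
    have [F [cF ->]] := open_bigcup_closed oU.
    apply: closed_approximable_bigcup => n; first exact: closed_borel.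
    exact: closed_approximable_closed.
  exact/closed_approximable_closed/open_closedC.
split=> [|B [mB aB aNB]|B GB].
- split; first exact: measurable0.
    exact/closed_approximable_closed/closed0.
  by rewrite setC0; exact/closed_approximable_closed/closedT.
- by rewrite setTD; split; [exact: measurableC|exact: aNB|rewrite setCK].
split; first by apply: bigcupT_measurable => n; have [] := GB n.
  by apply: closed_approximable_bigcup => n; have [] := GB n.
rewrite setC_bigcup; apply: closed_approximable_bigcap => n.
  by apply: measurableC; have [] := GB n.
by have [] := GB n.
Qed.

(** Closed sets approximating A from inside become compact when intersected
with K, at no cost in measure. *)
Lemma compact_inner_regular (K : set T) (A : set borel) :
  compact K -> nu (~` K) = 0 -> measurable A ->
  nu A = ereal_sup [set nu C | C in [set C : set T | compact C /\ C `<=` A]].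
Proof.
move=> Kc nuK mA; have T2 : hausdorff_space T := @norm_hausdorff _ _.
apply/le_anti/andP; split; last first.
  apply: ge_ereal_sup => _ [C [Cc CA] <-]; apply: le_measure; rewrite ?inE//.
  exact: closed_borel (compact_closed T2 Cc).
apply/lee_addgt0Pr => e e0.
have [F [cF FA nuF]] := borel_closed_approximable mA e0.
have cK : closed K by exact: compact_closed.
have FKc : compact (F `&` K) by rewrite setIC; exact: compact_closedI.
have [mF mK] : measurable (F : set borel) /\ measurable (K : set borel).
  by split; exact: closed_borel.
have AE : A `<=` (F `&` K) `|` ((A `\` F) `|` ~` K).
  move=> x Ax; have [Fx|nFx] := pselect (F x); last by right; left.
  by have [Kx|nKx] := pselect (K x); [left|right; right].
have mAF : measurable (A `\` F) by exact: measurableD.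
have mFK : measurable (F `&` K : set borel) by exact: measurableI.
have mNK : measurable (~` K : set borel) by exact: measurableC.
have mAFK : measurable ((A `\` F) `|` ~` K) by exact: measurableU.
apply: (@le_trans _ _ (nu (F `&` K) + (nu (A `\` F) + nu (~` K)))).
  apply: (@le_trans _ _ (nu ((F `&` K) `|` ((A `\` F) `|` ~` K)))).
    by apply: le_measure; rewrite ?inE//; exact: measurableU.
  by apply: le_trans (measureU2 _ mFK mAFK) _; rewrite leeD2l// measureU2.
rewrite nuK adde0 leeD//; apply: ereal_sup_ubound.
by exists (F `&` K) => //; split=> // x [/FA].
Qed.

End ClosedInnerRegularity.

(** * The moment problem *)

Section MomentProblem.
Variables (R : realType) (d k : nat) (f : 'I_k -> polyring R d).
Local Notation Q := (quadratic_module f).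
Local Notation K := (semialgebraic_set f).
Hypothesis Qarch : archimedean_qm Q.

(** For every c > 0 the polynomial p + c is positive on K, hence lies in Q
by part (i); let c tend to 0. *)
Lemma positive_on_peval_ge0 (L : {scalar polyring R d}) p : positive_on Q L ->
  (forall x, K x -> 0 <= peval p x) -> 0 <= L p.
Proof.
move=> LQ pK; have L1 : 0 <= L 1 by apply: LQ; exact: (quadratic_module_qmodule f).2.
apply/ler_addgt0Pr => e e0; pose c := e / (L 1 + 1).
have c0 : 0 < c by rewrite divr_gt0// ltr_wpDl.
have : 0 <= L (c *: 1 + p).
  apply/LQ/putinar => // x Kx; rewrite pevalD peval_scalar.
  by rewrite ltr_pwDl// pK.
rewrite linearD linearZ/= addrC => /le_trans; apply.
rewrite lerD2l /c mulrAC ler_pdivrMr ?ltr_wpDl//.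
by rewrite ler_wpM2l ?lerDl // ltW.
Qed.

Theorem positive_on_moment_functional (L : {scalar polyring R d}) :
  positive_on Q L -> moment_functional K L.
Proof.
move=> LQ; have Kc := compact_semialgebraic_set Qarch.
have [alpha alphaP alphaL] := positive_extension (@peval_linear R d)
  (@peval1 R d) (peval_bounded Qarch)
  (fun p => @positive_on_peval_ge0 L p LQ).
have [nu [nufin nuK nuint]] := @compact_representing_measure R 'rV[R]_d K alpha Kc alphaP.
exists nu; split.
- split=> [C Cc|A mA]; last exact: (@compact_inner_regular R 'rV[R]_d nu nufin K A Kc nuK mA).
  rewrite (le_lt_trans _ nufin)// le_measure ?inE//.
  by apply: closed_borel; apply: compact_closed Cc; exact: norm_hausdorff.
- exact: nuK.
- by move=> p; rewrite -alphaL; apply: nuint; exact: continuous_peval.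
Qed.

End MomentProblem.

Theorem theorem12p48 (R : realType) (d k : nat) (f : 'I_k -> polyring R d)
    (hQ : archimedean_qm (quadratic_module f)) :
  (forall h : polyring R d,
      (forall x : 'rV[R]_d, semialgebraic_set f x -> 0 < peval h x) ->
      quadratic_module f h) /\
  (forall L : {scalar polyring R d},
      positive_on (quadratic_module f) L ->
      compact (semialgebraic_set f) /\
      moment_functional (semialgebraic_set f) L).
Proof.
split=> [h hK|L LQ]; first exact: putinar.
split; first exact: compact_semialgebraic_set.
exact: positive_on_moment_functional.
Qed.
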